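(* In the genus 1 case, the group $\mathcal{H}$ is of order $8$ if and only if the determinant of the $3\times3$ matrix $M=(M_{ij})$ is equal to zero, where $$\begin{aligned} M_{11}&=2\Delta_{22}\Delta_{32}-(\Delta_{21}\Delta_{33}+\Delta_{31}\Delta_{23}),\\ M_{12}&=-2(\Delta_{22}^2+\Delta_{12}\Delta_{32}-\Delta_{21}\Delta_{23})+\Delta_{11}\Delta_{33}+\Delta_{31}\Delta_{13},\\ M_{13}&=2\Delta_{12}\Delta_{22}-(\Delta_{11}\Delta_{23}+\Delta_{21}\Delta_{13}),\\ M_{21}&=\Delta_{32}^2-\Delta_{31}\Delta_{33},\\ M_{22}&=-2\Delta_{32}\Delta_{22}+\Delta_{31}\Delta_{23}+\Delta_{21}\Delta_{33},\\ M_{23}&=\Delta_{22}^2-\Delta_{21}\Delta_{23},\\ M_{31}&=\Delta_{22}^2-\Delta_{21}\Delta_{23},\\ M_{32}&=-2\Delta_{22}\Delta_{12}+\Delta_{11}\Delta_{23}+\Delta_{13}\Delta_{21},\\ M_{33}&=\Delta_{12}^2-\Delta_{11}\Delta_{13}, \end{aligned}$$ and $\Delta_{ij}$ denotes the cofactor of the $(i,j)$-th entry of the matrix $$\mathbb{P}=\begin{pmatrix} p_{11}&p_{10}&p_{1,-1}\\ p_{01}&p_{00}-1&p_{0,-1}\\ p_{-1,1}&p_{-1,0}&p_{-1,-1}\end{pmatrix}.$$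
   Context: Let $p_{ij}\ge 0$, $-1\le i,j\le 1$, with $\sum_{i,j}p_{ij}=1$. Put $$Q(x,y)=xy\Big(1-\sum_{-1\le i,j\le 1}p_{ij}x^iy^j\Big).$$ Up to the sign of $Q$ (which is irrelevant, since only the curve $\{Q=0\}$ matters), $Q(x,y)=a(x)y^2+b(x)y+c(x)=\tilde a(y)x^2+\tilde b(y)x+\tilde c(y)$ with $a(x)=p_{1,1}x^2+p_{0,1}x+p_{-1,1}$, $b(x)=p_{1,0}x^2+(p_{0,0}-1)x+p_{-1,0}$, $c(x)=p_{1,-1}x^2+p_{0,-1}x+p_{-1,-1}$, $\tilde a(y)=p_{1,1}y^2+p_{1,0}y+p_{1,-1}$, $\tilde b(y)=p_{0,1}y^2+(p_{0,0}-1)y+p_{0,-1}$, $\tilde c(y)=p_{-1,1}y^2+p_{-1,0}y+p_{-1,-1}$. Standing assumption: $Q$ is irreducible of degree 2 in each variable and the algebraic curve $\{Q(x,y)=0\}$ has genus 1. Let $\mathbb{C}_Q(x,y)$ be the function field of this curve (the field of fractions of $\mathbb{C}[x,y]/(Q)$). Let $\xi,\eta$ be the $\mathbb{C}$-automorphisms of $\mathbb{C}_Q(x,y)$ determined by $\xi(x)=x$, $\xi(y)=\frac{c(x)}{y\,a(x)}$ and $\eta(y)=y$, $\eta(x)=\frac{\tilde c(y)}{x\,\tilde a(y)}$; they are involutions. The group of the random walk is $\mathcal{H}=\langle\xi,\eta\rangle$. Cofactors are signed: $\Delta_{ij}=(-1)^{i+j}$ times the minor obtained by deleting row $i$ and column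 $j$. *)

(* Defs.v *)
From HB Require Import structures.
From mathcomp Require Import all_boot all_order all_algebra.
From mathcomp Require Import complex.
From mathcomp Require Import all_classical reals.

Set Implicit Arguments.
Unset Strict Implicit.
Unset Printing Implicit Defensive.

Import Order.TTheory GRing.Theory Num.Theory.

Local Open Scope classical_set_scope.
Local Open Scope ring_scope.
Local Open Scope complex_scope.

(* Irreducible element of the ring A itself; for A = C[x][y], polydiv's
   [irreducible_poly] would be irreducibility over the field C(x). *)
Definition irreducible_elt (A : idomainType) (q : A) : Prop :=
  [/\ q != 0, q \isn't a GRing.unit &
      forall f g : A, q = f * g ->
        f \is a GRing.unit \/ g \is a GRing.unit].

Section FunctionField.

Variables (K F : fieldType) (iota : {rmorphism K -> F}).

(* K[x,y] is {poly {poly K}}: x is the inner variable 'X%:P and y the outer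
   variable 'X. *)
Definition eval1 (f : {poly K}) (u : F) : F := (map_poly iota f).[u].

Definition eval2 (f : {poly {poly K}}) (u v : F) : F :=
  (map_poly (map_poly iota) f).[v%:P].[u].

(* (F, x, y) is a model of Frac(K[x,y]/(Q)): the kernel of the evaluation
   K[x,y] -> F is exactly (Q), and every element of F is a quotient of two
   elements of its image.  This determines (F, x, y) up to a unique
   K-isomorphism. *)
Definition is_function_field (Q : {poly {poly K}}) (x y : F) : Prop :=
  (forall f, eval2 f x y = 0 <-> exists g, f = g * Q) /\
  (forall z, exists f g, eval2 g x y != 0 /\ z = eval2 f x y / eval2 g x y).

(* Places of F/K, given as normalized discrete valuations trivial on K.
   The value at 0 (usually +oo) is set to 0, so that each place corresponds to
   exactly one function. *)
Definition place : set (F -> int) := [set v |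
  [/\ v 0 = 0,
      forall c : K, c != 0 -> v (iota c) = 0,
      forall f g : F, f != 0 -> g != 0 -> v (f * g) = v f + v g,
      forall f g : F, f != 0 -> g != 0 -> f + g != 0 ->
        Num.min (v f) (v g) <= v (f + g) &
      exists2 t : F, t != 0 & v t = 1] ].

(* Only the values of D on [place] are relevant. *)
Definition is_divisor (D : (F -> int) -> int) : Prop :=
  finite_set (place `&` [set v | D v != 0]).

(* When K is algebraically closed every place has residue field K, hence
   degree 1. *)
Definition divisor_deg (D : (F -> int) -> int) : int := \sum_(v \in place) D v.

Definition riemann_roch_space (D : (F -> int) -> int) : set F :=
  [set f | f = 0 \/ forall v, place v -> - D v <= v f].

Definition has_dim (V : set F) (n : nat) : Prop :=
  exists b : 'I_n -> F,
    (forall c : 'I_n -> K,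
        \sum_(k < n) iota (c k) * b k = 0 -> forall k, c k = 0) /\
    V = [set f | exists c : 'I_n -> K, f = \sum_(k < n) iota (c k) * b k].

(* g = max_D (deg D - l(D) + 1), the genus of F/K for K algebraically closed;
   it is the (geometric) genus of any curve with function field F. *)
Definition has_genus (g : nat) : Prop :=
  (forall D n, is_divisor D -> has_dim (riemann_roch_space D) n ->
     divisor_deg D - n%:Z + 1 <= g%:Z) /\
  (exists D n, [/\ is_divisor D, has_dim (riemann_roch_space D) n &
     divisor_deg D - n%:Z + 1 = g%:Z]).

End FunctionField.

Definition is_automorphism (K F : fieldType) (iota : {rmorphism K -> F})
    (s : {rmorphism F -> F}) : Prop :=
  bijective s /\ forall c : K, s (iota c) = iota c.

Definition transformation_group (T : Type) (G : set (T -> T)) : Prop :=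
  [/\ G id,
      forall s t, G s -> G t -> G (s \o t) &
      forall s t, G s -> cancel s t -> cancel t s -> G t].

Definition generated_group (T : Type) (S : set (T -> T)) : set (T -> T) :=
  smallest (@transformation_group T) S.

Section RandomWalk.

Variables (R : realType) (p : int -> int -> R).

Definition steps : seq int := [:: -1; 0; 1].

(* The exponents i + 1 and j + 1 are nonnegative integers; the product of the
   Laurent polynomial 1 - sum p_ij x^i y^j by xy is expanded. *)
Definition walkQ : {poly {poly R[i]}} :=
  'X%:P * 'X
  - \sum_(i <- steps) \sum_(j <- steps)
      ((p i j)%:C)%:P%:P * ('X%:P) ^+ absz (i + 1) * 'X ^+ absz (j + 1).

Definition walk_a : {poly R[i]} :=
  (p 1 1)%:C *: 'X^2 + (p 0 1)%:C *: 'X + ((p (-1) 1)%:C)%:P.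

Definition walk_c : {poly R[i]} :=
  (p 1 (-1))%:C *: 'X^2 + (p 0 (-1))%:C *: 'X + ((p (-1) (-1))%:C)%:P.

Definition walk_a' : {poly R[i]} :=
  (p 1 1)%:C *: 'X^2 + (p 1 0)%:C *: 'X + ((p 1 (-1))%:C)%:P.

Definition walk_c' : {poly R[i]} :=
  (p (-1) 1)%:C *: 'X^2 + (p (-1) 0)%:C *: 'X + ((p (-1) (-1))%:C)%:P.

Definition mx33 (rows : seq (seq R)) : 'M[R]_3 :=
  \matrix_(i < 3, j < 3) nth 0 (nth [::] rows i) j.

Definition walkP : 'M[R]_3 := mx33
  [:: [:: p 1 1;    p 1 0;     p 1 (-1)];
      [:: p 0 1;    p 0 0 - 1; p 0 (-1)];
      [:: p (-1) 1; p (-1) 0;  p (-1) (-1)] ].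

(* Indices are 1-based here, whereas those of 'M_3 are 0-based. *)
Definition Delta (i j : nat) : R := cofactor walkP (inord i.-1) (inord j.-1).

Local Notation D := Delta.

Definition walkM : 'M[R]_3 := mx33
  [:: [:: 2 * D 2 2 * D 3 2 - (D 2 1 * D 3 3 + D 3 1 * D 2 3);
          - (2 * (D 2 2 ^+ 2 + D 1 2 * D 3 2 - D 2 1 * D 2 3))
            + D 1 1 * D 3 3 + D 3 1 * D 1 3;
          2 * D 1 2 * D 2 2 - (D 1 1 * D 2 3 + D 2 1 * D 1 3)];
      [:: D 3 2 ^+ 2 - D 3 1 * D 3 3;
          - (2 * D 3 2 * D 2 2) + D 3 1 * D 2 3 + D 2 1 * D 3 3;
          D 2 2 ^+ 2 - D 2 1 * D 2 3];
      [:: D 2 2 ^+ 2 - D 2 1 * D 2 3;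
          - (2 * D 2 2 * D 1 2) + D 1 1 * D 2 3 + D 1 3 * D 2 1;
          D 1 2 ^+ 2 - D 1 1 * D 1 3] ].

End RandomWalk.

(* Main.v *)
Require Import Defs.
From mathcomp Require Import all_boot all_order all_algebra.
From mathcomp Require Import polyXY complex ring zify.
From mathcomp Require Import all_classical reals.

(** The group is dihedral: generated by two nontrivial involutions, it has
    twice as many elements as the order of [xi \o eta]
    ([card_generated_group_two_involutions]).  So it has order 8 iff
    [(xi eta)^4 = 1] and [(xi eta)^2 <> 1], and the first equality says that
    [xi] commutes with [sigma = eta xi eta].

    The bridge to the matrix M is the element [z = eta x].  Its two conjugates
    [z] and [xi z] over C(x) are the roots of a polynomial
    [U Z^2 - T Z + S] with U, T, S of degree at most 2 in x: up to powers of x,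
    U and S are resultants in y of Q with the coefficients of [x^2] and of
    [x^0] in Q.  Computing these resultants gives the rows of M
    ([walkM_conj_roots]):
    [M (x^2, x, 1)^T = (T, U, S)^T = U (z + xi z, 1, z (xi z))^T].

    Suppose [(xi eta)^4 = 1].  Since [sigma] fixes [z] and commutes with [xi],
    it fixes [z + xi z] and [z (xi z)].  Hence M maps [(x^2, x, 1)] and its
    image under [sigma] to proportional vectors.  If M is invertible this
    forces [sigma x = x]; as F has degree 2 over C(x), [sigma] is then [xi],
    that is, [(xi eta)^2 = 1] ([order_four_det0]).

    Conversely, a linear dependence [c0, c1, c2] between the rows of M says
    [c0 (z + xi z) + c1 + c2 z (xi z) = 0], and [eta] turns it into
    [c0 (x + sigma x) + c1 + c2 x (sigma x) = 0].  So [sigma x] is a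
    homographic function of x, hence is fixed by [xi]; then [sigma xi sigma]
    fixes x, so it is [xi], and [(xi eta)^4 = 1].  If moreover
    [(xi eta)^2 = 1], then [sigma x = x] and the relation makes x algebraic
    over C, which is absurd ([det0_order_four]). *)

Set Implicit Arguments.
Unset Strict Implicit.

Import Order.TTheory GRing.Theory Num.Theory.
Local Open Scope classical_set_scope.
Local Open Scope card_scope.
Local Open Scope ring_scope.
Local Open Scope complex_scope.

(** * Groups generated by two involutions *)

Lemma iter_mul_involutionsK (T : Type) (s t : T -> T) k :
  involutive s -> involutive t -> cancel (iter k (t \o s)) (iter k (s \o t)).
Proof.
by move=> sK tK; elim: k => // k IH u; rewrite iterSr iterS /= tK sK.
Qed.

Lemma transformation_group_generated (T : Type) (S : set (T -> T)) :
  transformation_group (generated_group S).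
Proof.
split=> [G [[]]|f g Gf Gg G GG|f g Gf fK gK G GG] //.
- by case: (GG) => -[_ compG _] _; apply: compG; [exact: Gf|exact: Gg].
- by case: (GG) => -[_ _ invG] _; apply: invG fK gK; exact: Gf.
Qed.

Section TwoInvolutions.

Variables (T : Type) (s t : T -> T).
Hypotheses (sK : involutive s) (tK : involutive t).

Local Notation d := (s \o t).

(** The normal forms of a dihedral group: a rotation, then possibly a
    reflection. *)
Let word (k : nat) (b : bool) : T -> T := iter k d \o iter b s.

Lemma iter_conj_involution k u : s (iter k d (s u)) = iter k (t \o s) u.
Proof. by elim: k => [|k IH]; rewrite /= ?sK // -IH !sK. Qed.

Lemma iter_subn_id k l : (k <= l)%N -> iter k d = iter l d ->
  iter (l - k) d = id.
Proof.
move=> le_kl eq_kl; rewrite funeqE => u.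
by rewrite -[in LHS](iter_mul_involutionsK k sK tK u) -iterD subnK // -eq_kl
           iter_mul_involutionsK.
Qed.

Lemma generated_group_word k b : generated_group [set s; t] (word k b).
Proof.
have [G1 GM _] := transformation_group_generated [set s; t].
have Gs : generated_group [set s; t] s.
  by apply: sub_gen_smallest; left.
have Gt : generated_group [set s; t] t.
  by apply: sub_gen_smallest; right.
apply: (GM); last by case: b.
by elim: k => // k IH; apply: (GM (s \o t)) => //; apply: GM.
Qed.

(** The powers of [s \o t] all lie in the group, so they cannot be pairwise
    distinct when the group is finite. *)
Lemma exists_order : finite_set (generated_group [set s; t]) ->
  exists n, [/\ (0 < n)%N, iter n d = id &
    forall k, (0 < k)%N -> iter k d = id -> (n <= k)%N].
Proof.
move=> finG; pose P n := (0 < n)%N && `[<iter n d = id>].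
have exP : exists n, P n.
  apply: contrapT => noP.
  have d_inj : injective (fun k => iter k d).
    move=> k l; wlog le_kl : k l / (k <= l)%N => [H eq_kl|eq_kl].
      by have [/H|/ltnW/H] := leqP k l; [exact|move=> E; exact/esym/E].
    apply/eqP; rewrite eqn_leq le_kl leqNgt; apply/negP => lt_kl.
    apply: noP; exists (l - k)%N; rewrite /P subn_gt0 lt_kl; apply/asboolP.
    exact: iter_subn_id.
  have dG : (fun k => iter k d) @` [set: nat] `<=` generated_group [set s; t].
    by move=> _ [k _ <-]; exact: (generated_group_word k false).
  apply: infinite_nat; rewrite -(eq_finite_set (inj_card_eq (in2W d_inj))).
  exact: sub_finite_set dG finG.
exists (ex_minn exP); case: ex_minnP => n /andP[n0 /asboolP dn] n_min.
by split=> // k k0 dk; apply: n_min; rewrite /P k0; apply/asboolP.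
Qed.

Section FiniteOrder.

Variable n : nat.
Hypotheses (n_gt0 : (0 < n)%N) (d_n : iter n d = id).

Lemma iter_mod_order k : iter (k %% n) d = iter k d.
Proof.
have d_mul m : iter (m * n) d = id.
  by elim: m => // m IH; rewrite mulSn funeqE => u; rewrite iterD IH d_n.
by rewrite [in RHS](divn_eq k n) funeqE => u; rewrite iterD d_mul.
Qed.

Lemma iter_mul_involutionsV k : iter k (t \o s) = iter (n.-1 * k) d.
Proof.
rewrite funeqE => u.
rewrite -[in RHS](iter_mul_involutionsK k sK tK u) -iterD.
have -> : (n.-1 * k + k = k * n)%N by nia.
by rewrite -iter_mod_order modnMl.
Qed.

Lemma comp_word k b l c : exists m e, word k b \o word l c = word m e.
Proof.
case: b; last first.
  by exists (k + l)%N, c; rewrite funeqE => u; rewrite /word /= iterD.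
exists (k + n.-1 * l)%N, (~~ c); rewrite funeqE => u.
rewrite /word /= iterD -iter_mul_involutionsV -iter_conj_involution.
by case: c; rewrite /= ?sK.
Qed.

Lemma generated_group_words :
  generated_group [set s; t] = [set f | exists k b, f = word k b].
Proof.
apply/seteqP; split=> [|_ [k [b ->]]]; last exact: generated_group_word.
apply: smallest_sub; last first.
  move=> _ [->|->]; first by exists 0%N, true.
  exists n.-1, true; rewrite funeqE => u; rewrite /word /=.
  rewrite -[in RHS](tK u) -[in RHS](sK (t u)) -(iterSr n.-1 d) prednK //.
  by rewrite d_n.
split; first by exists 0%N, false.
  by move=> _ _ [k [b ->]] [l [c ->]]; exact: comp_word.
move=> _ g [k [b ->]] fK gK.
have [h [[m [e hE]] hK]] : exists h, (exists m e, h = word m e) /\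
    cancel h (word k b).
  case: b {fK gK}.
    exists (word k true); split; first by exists k, true.
    move=> u; rewrite /word /= iter_conj_involution.
    exact: (iter_mul_involutionsK k sK tK u).
  exists (iter k (t \o s)); split; last exact: (iter_mul_involutionsK k sK tK).
  by exists (n.-1 * k)%N, false; rewrite iter_mul_involutionsV.
exists m, e; rewrite -hE funeqE => u.
by rewrite -[in LHS](hK u) fK.
Qed.

Hypothesis d_min : forall k, (0 < k)%N -> iter k d = id -> (n <= k)%N.
Hypotheses (s_neq1 : s <> id) (t_neq1 : t <> id).

Lemma iter_inj k l : (k < n)%N -> (l < n)%N -> iter k d = iter l d -> k = l.
Proof.
wlog le_kl : k l / (k <= l)%N => [H lt_k lt_l eq_kl|lt_k lt_l eq_kl].
  by have [le_kl|/ltnW le_lk] := leqP k l; [|symmetry]; apply: H.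
apply/eqP; rewrite eqn_leq le_kl leqNgt.
apply/negP => lt_kl; suff : (n <= l - k)%N by lia.
by apply: d_min; [lia|exact: iter_subn_id].
Qed.

(** A rotation equal to [s] would commute with [s \o t], which [s] inverts;
    so [s \o t] would have order at most 2, leaving [s = id] or
    [s = s \o t]. *)
Lemma involution_not_iter k : (k < n)%N -> s <> iter k d.
Proof.
move=> lt_kn sE.
have d2 : iter 2 d = id.
  have cs u : d (s u) = s (d u).
    transitivity (iter k.+1 d u); first by rewrite iterS -sE.
    by rewrite iterSr -sE.
  by rewrite funeqE => u; have /= -> := cs (t u); rewrite sK tK.
case: k sE lt_kn => [|[|k]] sE lt_kn; first exact: s_neq1.
  2: by have := leq_trans lt_kn (@d_min 2 isT d2).
apply: t_neq1; rewrite funeqE => u.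
by apply: (can_inj sK); rewrite -[LHS]/(iter 1 d u) -sE.
Qed.

Lemma iter_comp_involution_neq k l : iter k d \o s <> iter l d.
Proof.
move=> /funeqP eq_kl.
have sE : s = iter (n.-1 * k + l) d.
  rewrite funeqE => u; rewrite iterD -(eq_kl u) -iter_mul_involutionsV.
  exact/esym/(iter_mul_involutionsK k tK sK).
apply: (involution_not_iter (ltn_pmod (n.-1 * k + l) n_gt0)).
by rewrite iter_mod_order.
Qed.

Lemma card_generated_group_two_involutions :
  generated_group [set s; t] #= `I_(n.*2).
Proof.
have -> : generated_group [set s; t] =
    (fun m => word m./2 (odd m)) @` `I_(n.*2).
  rewrite generated_group_words; apply/seteqP; split=> f /=.
    move=> [k [b ->]]; exists (b + (k %% n).*2)%N.
      by have := ltn_pmod k n_gt0; case: b => /=; lia.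
    by rewrite oddD odd_double addbF oddb half_bit_double /word iter_mod_order.
  by move=> [m _ <-]; exists m./2, (odd m).
apply: inj_card_eq => k l.
rewrite !in_setE /= => lt_k lt_l.
have lt_k2 : (k./2 < n)%N by lia.
have lt_l2 : (l./2 < n)%N by lia.
move=> /funeqP eq_kl; have eq_odd : odd k = odd l.
  case: (odd k) (odd l) eq_kl => [] [] //= /funeqP eq_kl; exfalso.
    exact: iter_comp_involution_neq eq_kl.
  exact: iter_comp_involution_neq (esym eq_kl).
rewrite -(odd_double_half k) -(odd_double_half l) eq_odd.
congr (_ + _.*2)%N; apply: iter_inj => //; rewrite funeqE => u.
have := eq_kl (iter (odd k) s u); rewrite /word /= -eq_odd.
by case: (odd k); rewrite /= ?sK.
Qed.

End FiniteOrder.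
End TwoInvolutions.

(** Among the orders 1, 2, 4 allowed by [(st)^4 = 1], the condition
    [(st)^2 <> 1] selects 4. *)
Lemma card_two_involutions_eq8 (T : Type) (s t : T -> T) :
    involutive s -> involutive t -> s <> id -> t <> id ->
  generated_group [set s; t] #= `I_8 <->
  iter 4 (s \o t) = id /\ iter 2 (s \o t) <> id.
Proof.
move=> sK tK s1 t1; pose d := s \o t.
have cardE n : (0 < n)%N -> iter n d = id ->
    (forall k, (0 < k)%N -> iter k d = id -> (n <= k)%N) ->
    generated_group [set s; t] #= `I_(n.*2).
  by move=> *; exact: card_generated_group_two_involutions.
split=> [card8|[d4 d2]]; last first.
  have d1 : d <> id.
    by move=> dE; apply: d2; rewrite -/d dE.
  apply: (cardE 4%N) => // -[|[|[|[|k]]]] // _ dk; exfalso.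
  by apply: d1; move: d4; rewrite -/d (_ : iter 4 d = d \o iter 3 d) // dk.
have finG : finite_set (generated_group [set s; t]).
  by apply/finite_setP; exists 8%N.
have [n [n_gt0 dn d_min]] := exists_order sK tK finG.
have n4 : n = 4%N.
  have /card_eq_II : `I_(n.*2) #= `I_8.
    by rewrite -(card_eql (cardE n n_gt0 dn d_min)).
  lia.
by rewrite -/d -n4; split=> // /(@d_min 2 isT); rewrite n4.
Qed.

(** * Evaluation of polynomials in a function field *)

Section Evaluation.

Variables (K F : fieldType) (iota : {rmorphism K -> F}).

Lemma eval1_MXaddC f c (u : F) :
  eval1 iota (f * 'X + c%:P) u = eval1 iota f u * u + iota c.
Proof. by rewrite /eval1 rmorphD rmorphM /= map_polyX map_polyC !hornerE. Qed.

Lemma eval2D f g (u v : F) :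
  eval2 iota (f + g) u v = eval2 iota f u v + eval2 iota g u v.
Proof. by rewrite /eval2 rmorphD !hornerD. Qed.

Lemma eval2M f g (u v : F) :
  eval2 iota (f * g) u v = eval2 iota f u v * eval2 iota g u v.
Proof. by rewrite /eval2 rmorphM !hornerM. Qed.

Lemma eval2C c (u v : F) : eval2 iota c%:P u v = eval1 iota c u.
Proof. by rewrite /eval2 map_polyC hornerC. Qed.

Lemma eval2X (u v : F) : eval2 iota 'X u v = v.
Proof. by rewrite /eval2 map_polyX hornerX hornerC. Qed.

Lemma eval2_swapXY f (u v : F) : eval2 iota (swapXY f) u v = eval2 iota f v u.
Proof.
have eval2_map g : eval2 iota (map_poly polyC g) u v = eval1 iota g v.
  elim/poly_ind: g => [|g c IH].
    by rewrite rmorph0 /eval2 /eval1 !rmorph0 !horner0.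
  rewrite rmorphD rmorphM /= map_polyX map_polyC eval2D eval2M eval2X eval2C IH.
  by rewrite eval1_MXaddC /eval1 map_polyC hornerC.
elim/poly_ind: f => [|f c IH].
  by rewrite rmorph0 /eval2 !rmorph0 !horner0.
rewrite rmorphD rmorphM /= swapXY_X swapXY_polyC !eval2D !eval2M eval2_map.
rewrite eval2X !eval2C IH; congr (_ * _ + _).
by rewrite /eval1 map_polyX hornerX.
Qed.

Lemma rmorph_eval1 (s : {rmorphism F -> F}) f (u : F) :
  (forall c, s (iota c) = iota c) -> s (eval1 iota f u) = eval1 iota f (s u).
Proof.
move=> s_iota; elim/poly_ind: f => [|f c IH].
  by rewrite /eval1 rmorph0 !horner0 rmorph0.
by rewrite !eval1_MXaddC rmorphD rmorphM s_iota IH.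
Qed.

Lemma rmorph_eval2 (s : {rmorphism F -> F}) f (u v : F) :
  (forall c, s (iota c) = iota c) ->
  s (eval2 iota f u v) = eval2 iota f (s u) (s v).
Proof.
move=> s_iota; elim/poly_ind: f => [|f c IH].
  by rewrite /eval2 rmorph0 !horner0 rmorph0.
by rewrite !(eval2D, eval2M, eval2C, eval2X) rmorphD rmorphM rmorph_eval1 // IH.
Qed.

Lemma is_function_field_swapXY Q (x y : F) :
  is_function_field iota Q x y -> is_function_field iota (swapXY Q) y x.
Proof.
move=> [kerQ gen]; split=> [f|z].
  rewrite -[f]swapXYK eval2_swapXY kerQ; split=> -[g gE].
    by exists (swapXY g); rewrite gE rmorphM.
  exists (swapXY g); apply: (can_inj swapXYK).
  by rewrite gE rmorphM /= !swapXYK.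
have [f [g [gn0 ->]]] := gen z.
by exists (swapXY f), (swapXY g); rewrite !eval2_swapXY.
Qed.

Lemma is_function_fieldN Q (x y : F) :
  is_function_field iota (- Q) x y -> is_function_field iota Q x y.
Proof.
move=> [kerQ gen]; split=> // f; rewrite kerQ.
by split=> -[g ->]; exists (- g); rewrite ?mulrNN // mulrN mulNr.
Qed.

End Evaluation.

Lemma eval1_quadratic (K F : fieldType) (iota : {rmorphism K -> F})
    (c2 c1 c0 : K) (u : F) :
  eval1 iota (c2 *: 'X^2 + c1 *: 'X + c0%:P) u =
  iota c2 * u ^+ 2 + iota c1 * u + iota c0.
Proof.
have -> : c2 *: 'X^2 + c1 *: 'X + c0%:P = ((c2%:P * 'X) + c1%:P) * 'X + c0%:P.
  by rewrite mulrDl -mulrA !mul_polyC.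
by rewrite !eval1_MXaddC /eval1 map_polyC hornerC /=; ring.
Qed.

Lemma quadratic_eq0 (K : fieldType) (c2 c1 c0 : K) :
  c2 *: 'X^2 + c1 *: 'X + c0%:P = 0 -> [/\ c2 = 0, c1 = 0 & c0 = 0].
Proof.
by move=> /polyP E; split; [have := E 2%N|have := E 1%N|have := E 0%N];
   rewrite !coefD !coefZ coefXn coefX coefC coef0 /=
     ?(mulr0, mulr1, addr0, add0r).
Qed.

Lemma size_linear_leq2 (A : nzRingType) (b c : A) :
  (size (b%:P * 'X + c%:P)%R <= 2)%N.
Proof.
by rewrite size_MXaddC; case: ifP => // _; rewrite ltnS size_polyC leq_b1.
Qed.

(** * Function fields of curves of degree 2 over a rational field *)

Section QuadraticExtension.

Variables (K F : fieldType) (iota : {rmorphism K -> F}) (A B C : {poly K}).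
Variables (x y : F).
Hypothesis char2 : 2%:R != 0 :> K.
Hypothesis A_neq0 : A != 0.
Local Notation Q := (A%:P * 'X^2 + B%:P * 'X + C%:P).
Hypothesis FQ : is_function_field iota Q x y.

Local Notation Ax := (eval1 iota A x).
Local Notation Bx := (eval1 iota B x).
Local Notation Cx := (eval1 iota C x).

(** A multiple of Q has degree at least 2 in the outer variable.  Taking
    degrees 0 and 1 shows that x is transcendental over K and that y is not
    in K(x). *)
Lemma eval2_small_eq0 (f : {poly {poly K}}) :
  (size f <= 2)%N -> eval2 iota f x y = 0 -> f = 0.
Proof.
move=> le_f2 /(FQ.1 f)[g fE]; apply/eqP; apply: contraT => f_neq0.
have sizeQ : size Q = 3%N.
  by rewrite -addrA size_polyDl size_Cmul ?size_polyXn // ltnS size_linear_leq2.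
have g_neq0 : g != 0 by apply: contraNneq f_neq0 => g0; rewrite fE g0 mul0r.
have Q_neq0 : Q != 0 by rewrite -size_poly_eq0 sizeQ.
move: le_f2; rewrite fE size_mul // sizeQ.
by move: g_neq0; rewrite -size_poly_gt0; case: (size g) => // n; rewrite addn3.
Qed.

Lemma eval1_eq0 f : eval1 iota f x = 0 -> f = 0.
Proof.
rewrite -(eval2C iota f x y) => /eval2_small_eq0 fP.
by apply/polyC_inj/fP; rewrite size_polyC leqW ?leq_b1.
Qed.

Lemma base_neq0 : x != 0.
Proof.
apply/eqP => x0; have /eqP : 'X = 0 :> {poly K}; last by rewrite polyX_eq0.
by apply: eval1_eq0; rewrite /eval1 map_polyX hornerX.
Qed.

Lemma lead_neq0 : Ax != 0.
Proof. by apply: contraNneq A_neq0 => /eval1_eq0 ->. Qed.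

Lemma gen_neq0 : y != 0.
Proof.
apply/eqP => y0.
have /eqP : 'X = 0 :> {poly {poly K}}; last by rewrite polyX_eq0.
by apply: eval2_small_eq0; rewrite ?size_polyX // eval2X.
Qed.

Lemma curve_eq : Ax * y ^+ 2 + Bx * y + Cx = 0.
Proof.
have : eval2 iota Q x y = 0 by apply/FQ.1; exists 1; rewrite mul1r.
by rewrite !(eval2D, eval2M, eval2C, eval2X).
Qed.

Lemma automorphism_ext (s t : {rmorphism F -> F}) :
  (forall c, s (iota c) = iota c) -> (forall c, t (iota c) = iota c) ->
  s x = t x -> s y = t y -> s = t :> (F -> F).
Proof.
move=> s_iota t_iota eq_x eq_y; rewrite funeqE => w.
have [f [g [_ ->]]] := FQ.2 w.
by rewrite !fmorph_div !rmorph_eval2 // eq_x eq_y.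
Qed.

Variable s : {rmorphism F -> F}.
Hypothesis s_iota : forall c, s (iota c) = iota c.
Hypothesis s_x : s x = x.
Hypothesis s_y : s y = Cx / (y * Ax).

Lemma conj_prod : Ax * (y * s y) = Cx.
Proof. by rewrite s_y; field; rewrite gen_neq0 lead_neq0. Qed.

Lemma conj_sum : Ax * (y + s y) = - Bx.
Proof.
apply: (mulfI gen_neq0); apply/eqP; rewrite -subr_eq0; apply/eqP.
rewrite -[RHS]curve_eq -conj_prod; ring.
Qed.

Lemma conj_involutive : involutive s.
Proof.
suff : s \o s = id by move/funeqP.
apply: (@automorphism_ext (s \o s) idfun) => /=.
- by move=> c; rewrite !s_iota.
- by [].
- by rewrite !s_x.
have s_y_neq0 : s y != 0 by rewrite fmorph_eq0 gen_neq0.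
rewrite [in LHS]s_y fmorph_div rmorphM !rmorph_eval1 // s_x -conj_prod.
by field; rewrite s_y_neq0 lead_neq0.
Qed.

(** If [s y = y], then y would be the rational function [- B / (2 A)] of x. *)
Lemma conj_neq_id : s <> id :> (F -> F).
Proof.
move=> /funeqP s_id; have := conj_sum; rewrite s_id => E.
have /(congr1 (fun f : {poly {poly K}} => f`_1)) :
    (2%:R * A)%:P * 'X + B%:P = 0.
  apply: eval2_small_eq0; first exact: size_linear_leq2.
  rewrite !(eval2D, eval2M, eval2C, eval2X) /eval1 rmorphM rmorph_nat.
  rewrite hornerM -polyC_natr hornerC -!/(eval1 _ _ _).
  have -> : eval1 iota B x = - (Ax * (y + y)) by rewrite E opprK.
  by ring.
rewrite coefD coefCM coefX coefC mulr1 addr0 coef0 => /eqP.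
by rewrite mulf_eq0 (negPf A_neq0) orbF -polyC_natr polyC_eq0 (negPf char2).
Qed.

(** The roots of Q over K(x) are [y] and [s y], and an automorphism over K(x)
    is determined by the root to which it sends [y]. *)
Lemma galois_quadratic (t : {rmorphism F -> F}) :
  (forall c, t (iota c) = iota c) -> t x = x ->
  t = id :> (F -> F) \/ t = s :> (F -> F).
Proof.
move=> t_iota t_x.
have : Ax * (t y - y) * (t y - s y) = 0.
  have <- : t (Ax * y ^+ 2 + Bx * y + Cx) = 0 by rewrite curve_eq rmorph0.
  rewrite !(rmorphD, rmorphM) /= !rmorph_eval1 // t_x -conj_prod.
  have -> : Bx = - (Ax * (y + s y)) by rewrite conj_sum opprK.
  by ring.
move/eqP; rewrite !mulf_eq0 (negPf lead_neq0) !subr_eq0.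
by case/orP=> /eqP t_y; [left; apply: (@automorphism_ext t idfun)
                       |right; apply: automorphism_ext]; rewrite ?s_x.
Qed.

End QuadraticExtension.

(** * The matrix M and the conjugates of eta x *)

Lemma det_mx22 (A : comNzRingType) (N : 'M[A]_2) :
  \det N = N 0 0 * N 1 1 - N 0 1 * N 1 0.
Proof.
rewrite (expand_det_row _ 0) !big_ord_recl big_ord0 /cofactor !det_mx11 !mxE /=.
have -> : lift 0 0 = 1 :> 'I_2 by apply/val_inj.
have -> : lift 1 0 = 0 :> 'I_2 by apply/val_inj.
by rewrite /= !addr0; ring.
Qed.

(** The left-hand side is the resultant of [f2 Y^2 + f1 Y + f0] and
    [a Y^2 + b Y + c], whose roots are [y] and [y']; it is a symmetric function
    of these roots. *)
Lemma prod_over_conj_roots (A : comNzRingType) (f2 f1 f0 a b c y y' : A) :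
  a * (y + y') = - b -> a * (y * y') = c ->
  a ^+ 2 * ((f2 * y ^+ 2 + f1 * y + f0) * (f2 * y' ^+ 2 + f1 * y' + f0)) =
  f2 ^+ 2 * c ^+ 2 - f2 * f1 * (b * c) + f2 * f0 * (b ^+ 2 - 2 * (a * c)) +
  f1 ^+ 2 * (a * c) - f1 * f0 * (a * b) + f0 ^+ 2 * a ^+ 2.
Proof. by move=> /esym/(canRL (@opprK _)) -> <-; ring. Qed.

(** The polar form of this resultant, which is a quadratic form in
    [(f2, f1, f0)]. *)
Lemma polar_over_conj_roots (A : comNzRingType)
    (f2 f1 f0 g2 g1 g0 a b c y y' : A) :
  a * (y + y') = - b -> a * (y * y') = c ->
  a ^+ 2 * ((f2 * y ^+ 2 + f1 * y + f0) * (g2 * y' ^+ 2 + g1 * y' + g0) +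
            (g2 * y ^+ 2 + g1 * y + g0) * (f2 * y' ^+ 2 + f1 * y' + f0)) =
  2 * (f2 * g2) * c ^+ 2 - (f2 * g1 + f1 * g2) * (b * c) +
  (f2 * g0 + f0 * g2) * (b ^+ 2 - 2 * (a * c)) + 2 * (f1 * g1) * (a * c) -
  (f1 * g0 + f0 * g1) * (a * b) + 2 * (f0 * g0) * a ^+ 2.
Proof. by move=> /esym/(canRL (@opprK _)) -> <-; ring. Qed.

Section Walk.

Variables (R : realType) (p : int -> int -> R).

Lemma DeltaE :
  (Delta p 1 1 = (p 0 0 - 1) * p (-1) (-1) - p 0 (-1) * p (-1) 0) *
  (Delta p 1 2 = p 0 (-1) * p (-1) 1 - p 0 1 * p (-1) (-1)) *
  (Delta p 1 3 = p 0 1 * p (-1) 0 - (p 0 0 - 1) * p (-1) 1) *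
  (Delta p 2 1 = p 1 (-1) * p (-1) 0 - p 1 0 * p (-1) (-1)) *
  (Delta p 2 2 = p 1 1 * p (-1) (-1) - p 1 (-1) * p (-1) 1) *
  (Delta p 2 3 = p 1 0 * p (-1) 1 - p 1 1 * p (-1) 0) *
  (Delta p 3 1 = p 1 0 * p 0 (-1) - p 1 (-1) * (p 0 0 - 1)) *
  (Delta p 3 2 = p 1 (-1) * p 0 1 - p 1 1 * p 0 (-1)) *
  (Delta p 3 3 = p 1 1 * (p 0 0 - 1) - p 1 0 * p 0 1).
Proof.
rewrite /Delta /cofactor !det_mx22 !mxE /= /bump /= !inordK //=.
do !split; ring.
Qed.

Variables (F : fieldType) (phi : {rmorphism R -> F}).

Local Notation q i j := (phi (p i j)).
Local Notation m k l := (phi (walkM p (inord k.-1) (inord l.-1))).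

Definition walkM_row k (u : F) := m k 1 * u ^+ 2 + m k 2 * u + m k 3.

(** [walk_rowF i] and [walk_colF j] are the coefficients of [- Q] at [x^(i+1)]
    and at [y^(j+1)]; the term [xy] of Q only meets the middle ones. *)
Definition walk_rowF i u :=
  q i 1 * u ^+ 2 + (q i 0 - (i == 0)%:R) * u + q i (-1).

Definition walk_colF j u :=
  q 1 j * u ^+ 2 + (q 0 j - (j == 0)%:R) * u + q (-1) j.

(** Here [y] and [y'] are the two points over x, and [z], [z'] the second
    points over [y], [y'].  At a zero of [walk_rowF 1], Q reduces to
    [- (x walk_rowF 0 + walk_rowF (-1))], so that the resultant U has degree 2
    in x instead of 4, with coefficients built from 2 x 2 minors of the matrix
    of the walk.  The same happens for S, after division by [x^2]. *)
Lemma walkM_conj_roots (x y y' z z' : F) : x != 0 ->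
  walk_colF 1 x * (y + y') = - walk_colF 0 x ->
  walk_colF 1 x * (y * y') = walk_colF (-1) x ->
  walk_rowF 1 y * (x + z) = - walk_rowF 0 y ->
  walk_rowF 1 y' * (x + z') = - walk_rowF 0 y' ->
  walk_rowF 1 y * (x * z) = walk_rowF (-1) y ->
  walk_rowF 1 y' * (x * z') = walk_rowF (-1) y' ->
  let U := walk_colF 1 x ^+ 2 * (walk_rowF 1 y * walk_rowF 1 y') in
  [/\ walkM_row 1 x = U * (z + z'), walkM_row 2 x = U &
      walkM_row 3 x = U * (z * z')].
Proof.
move=> x0 sum_y prod_y az az' xz xz' U.
have UE : U = walkM_row 2 x.
  rewrite /U (prod_over_conj_roots _ _ _ sum_y prod_y).
  rewrite /walkM_row /walk_colF !mxE /= !inordK //= !DeltaE; ring.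
have xxS : x ^+ 2 * walkM_row 3 x =
    walk_colF 1 x ^+ 2 * (walk_rowF (-1) y * walk_rowF (-1) y').
  rewrite (prod_over_conj_roots _ _ _ sum_y prod_y).
  rewrite /walkM_row /walk_colF !mxE /= !inordK //= !DeltaE; ring.
(* This is [z = - x - walk_rowF 0 y / walk_rowF 1 y], summed over the
   conjugates. *)
have TE : walkM_row 1 x = - (2 * x * U) - walk_colF 1 x ^+ 2 *
    (walk_rowF 0 y * walk_rowF 1 y' + walk_rowF 1 y * walk_rowF 0 y').
  rewrite UE (polar_over_conj_roots _ _ _ _ _ _ sum_y prod_y).
  rewrite /walkM_row /walk_colF !mxE /= !inordK //= !DeltaE; ring.
split; rewrite ?UE //.
  rewrite TE -UE /U -[walk_rowF 0 y]opprK -[walk_rowF 0 y']opprK -az -az'.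
  by ring.
apply: (mulfI (expf_neq0 2 x0)); rewrite xxS -UE /U -xz -xz'; ring.
Qed.

End Walk.

Section WalkMatrix.

Variables (R : realType) (p : int -> int -> R) (F : fieldType).
Variable phi : {rmorphism R -> F}.

Let veronese (u : F) : 'cV[F]_3 := \col_(j < 3) u ^+ (2 - j).

Lemma walkM_rowE u :
  map_mx phi (walkM p) *m veronese u = \col_(k < 3) walkM_row p phi k.+1 u.
Proof.
apply/matrixP => k j; rewrite ord1 {j} !mxE.
rewrite !big_ord_recl big_ord0 /walkM_row addr0 addrA /= !mxE /=.
have -> : inord k = k :> 'I_3 by apply/val_inj; rewrite /= inordK.
by rewrite !inordK // expr1 mulr1.
Qed.

(** For M invertible the rows are a projective embedding of the line: the
    vector [(u^2, u, 1)] is recovered up to a factor, which its last entry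
    normalizes. *)
Lemma walkM_row_proportional_inj (u v a b : F) :
  \det (walkM p) != 0 -> a != 0 ->
  (forall k, (0 < k <= 3)%N ->
     a * walkM_row p phi k u = b * walkM_row p phi k v) -> u = v.
Proof.
move=> detM a0 eq_rows.
have M_unit : map_mx phi (walkM p) \in unitmx.
  by rewrite unitmxE det_map_mx unitfE fmorph_eq0.
have eqV : a *: veronese u = b *: veronese v.
  apply: (can_inj (mulKmx M_unit)); rewrite -!scalemxAr !walkM_rowE.
  by apply/matrixP => k j; rewrite !mxE eq_rows //= ltn_ord.
have /matrixP/(_ ord_max 0) := eqV; rewrite !mxE /= !mulr1 => ab.
have /matrixP/(_ 1 0) := eqV; rewrite !mxE /= ab => /mulfI; apply.
by rewrite -ab.
Qed.

Lemma walkM_row_dependence :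
  \det (walkM p) = 0 -> exists c : nat -> R,
    (exists2 k, (k < 3)%N & c k != 0) /\
    forall u, phi (c 0) * walkM_row p phi 1 u +
      phi (c 1) * walkM_row p phi 2 u + phi (c 2) * walkM_row p phi 3 u = 0.
Proof.
move=> /eqP/det0P[v v0 vM].
exists (fun k => v 0 (inord k)); split.
  have /rV0Pn[k vk] := v0; exists k => //.
  by rewrite (_ : inord k = k) //; apply/val_inj; rewrite /= inordK.
move=> u.
have : map_mx phi v *m (map_mx phi (walkM p) *m veronese u) = 0.
  by rewrite mulmxA -map_mxM vM map_mx0 mul0mx.
rewrite walkM_rowE => /matrixP/(_ 0 0).
rewrite !mxE !big_ord_recl big_ord0 /= !mxE addr0 addrA => <-.
by congr (_ + _ + _); rewrite /=; congr (phi (v _ _) * _); apply/val_inj;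
   rewrite /= inordK.
Qed.

End WalkMatrix.

(** * The curve of the walk *)

Section WalkCurve.

Variables (R : realType) (p : int -> int -> R).

Definition walk_b : {poly R[i]} :=
  (p 1 0)%:C *: 'X^2 + ((p 0 0)%:C - 1) *: 'X + ((p (-1) 0)%:C)%:P.

Lemma walkQE :
  walkQ p = - ((walk_a p)%:P * 'X^2 + walk_b%:P * 'X + (walk_c p)%:P).
Proof.
rewrite /walkQ /steps !big_cons !big_nil /walk_a /walk_b /walk_c /absz /=.
rewrite -!mul_polyC.
move: (p 1 1)%:C (p 1 0)%:C (p 1 (-1))%:C (p 0 1)%:C (p 0 0)%:C.
move: (p 0 (-1))%:C (p (-1) 1)%:C (p (-1) 0)%:C (p (-1) (-1))%:C => *.
ring.
Qed.

End WalkCurve.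

(** Exchanging x and y transposes the steps, so that results on [xi] apply to
    [eta]. *)
Lemma walkQ_transpose (R : realType) (p : int -> int -> R) :
  walkQ (fun i j => p j i) = swapXY (walkQ p).
Proof.
rewrite /walkQ rmorphB rmorphM /= swapXY_X swapXY_Y mulrC.
congr (_ - _); rewrite exchange_big rmorph_sum /=; apply: eq_bigr => i _.
rewrite rmorph_sum /=; apply: eq_bigr => j _; move: (p i j)%:C => c.
rewrite 2!rmorphM 2!rmorphXn /= swapXY_X swapXY_Y.
by rewrite swapXY_polyC map_polyC mulrAC.
Qed.

(** * The criterion for the product of the involutions to have order 4 *)

Section Criterion.

Variables (R : realType) (p : int -> int -> R) (F : fieldType).
Variables (iota : {rmorphism R[i] -> F}) (x : F) (xi eta : {rmorphism F -> F}).
Hypotheses (xi_iota : forall c, xi (iota c) = iota c)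
           (eta_iota : forall c, eta (iota c) = iota c).
Hypotheses (xiK : involutive xi) (etaK : involutive eta).
Hypotheses (xi_neq1 : xi <> id :> (F -> F)) (xi_x : xi x = x).
Hypothesis x_transcendental : forall f, eval1 iota f x = 0 -> f = 0.
Hypothesis xi_galois : forall t : {rmorphism F -> F},
  (forall c, t (iota c) = iota c) -> t x = x ->
  t = id :> (F -> F) \/ t = xi :> (F -> F).

Let phi : {rmorphism R -> F} := iota \o real_complex R.
Local Notation z := (eta x).
Local Notation U := (walkM_row p phi 2 x).

Hypothesis U_neq0 : U != 0.
Hypothesis row1 : walkM_row p phi 1 x = U * (z + xi z).
Hypothesis row3 : walkM_row p phi 3 x = U * (z * xi z).

Let sigma : {rmorphism F -> F} := eta \o xi \o eta.

Let sigma_iota c : sigma (iota c) = iota c.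
Proof. by rewrite /= !(eta_iota, xi_iota). Qed.

Let sigmaK : involutive sigma.
Proof. by move=> u; rewrite /= etaK xiK etaK. Qed.

Let sigma_z : sigma z = z.
Proof. by rewrite /= etaK xi_x. Qed.

Lemma quadratic_at_gen_eq0 (c2 c1 c0 : R) :
  phi c2 * x ^+ 2 + phi c1 * x + phi c0 = 0 -> [/\ c2 = 0, c1 = 0 & c0 = 0].
Proof.
rewrite -(eval1_quadratic iota) => /x_transcendental /quadratic_eq0[E2 E1 E0].
by split; apply: (fmorph_inj (real_complex R)); rewrite rmorph0.
Qed.

Lemma sigma_walkM_row k :
  sigma (walkM_row p phi k x) = walkM_row p phi k (sigma x).
Proof.
by rewrite /walkM_row !(rmorphD sigma, rmorphM sigma, rmorphXn sigma)
           !sigma_iota.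
Qed.

Lemma order_four_det0 :
  iter 4 (xi \o eta) = id -> iter 2 (xi \o eta) <> id -> \det (walkM p) = 0.
Proof.
move=> d4 d2; apply/eqP; apply: contra_notT d2 => detM.
have sigma_xi u : sigma (xi u) = xi (sigma u).
  have : iter 4 (xi \o eta) (sigma (xi u)) = sigma (xi u) by rewrite d4.
  by rewrite /= !(etaK, xiK) => ->.
have sx : sigma x = x.
  apply/esym; apply: (walkM_row_proportional_inj (phi := phi) (a := sigma U)
    (b := U) detM); first by rewrite fmorph_eq0.
  have sw : sigma (z + xi z) = z + xi z /\ sigma (z * xi z) = z * xi z.
    by rewrite rmorphD rmorphM sigma_xi sigma_z.
  move=> [|[|[|[|k]]]] //= _; rewrite -sigma_walkM_row ?row1 ?row3.
  - by rewrite [in RHS]rmorphM sw.1; ring.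
  - by ring.
  - by rewrite [in RHS]rmorphM sw.2; ring.
case: (xi_galois sigma_iota sx) => /funeqP sE.
  case: xi_neq1; rewrite funeqE => u.
  by have := sE (eta u); rewrite /= etaK => /(can_inj etaK).
by rewrite funeqE => u; have /= := sE u => ->; rewrite xiK.
Qed.

Lemma det0_order_four :
  \det (walkM p) = 0 -> iter 4 (xi \o eta) = id /\ iter 2 (xi \o eta) <> id.
Proof.
move=> /(walkM_row_dependence phi)[c [[k lt_k3 ck] /(_ x)]].
rewrite row1 row3 => dep.
have rel_z : phi (c 0%N) * (z + xi z) + phi (c 1%N)
    + phi (c 2%N) * (z * xi z) = 0.
  by apply: (mulfI U_neq0); rewrite mulr0 -[RHS]dep; ring.
have rel_x : phi (c 0%N) * (x + sigma x) + phi (c 1%N)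
    + phi (c 2%N) * (x * sigma x) = 0.
  have /(congr1 eta) := rel_z.
  by rewrite !(rmorphD eta, rmorphM eta) !eta_iota etaK rmorph0.
have c_eq0 : c 0%N = 0 -> c 1%N = 0 -> c 2%N = 0 -> False.
  by move=> c0 c1 c2; move: ck; case: k lt_k3 => [|[|[|k]]] //;
     rewrite ?c0 ?c1 ?c2 eqxx.
split=> [|d2].
  (* [rel_x] gives [sigma x = - (c0 x + c1) / (c2 x + c0)]: if the denominator
     vanished, so would [c0] and [c2], and then [c1]. *)
  have den_neq0 : phi (c 2%N) * x + phi (c 0%N) != 0.
    apply/eqP => den0.
    have [_ c2 c0] : [/\ 0 = 0 :> R, c 2%N = 0 & c 0%N = 0].
      by apply: quadratic_at_gen_eq0; rewrite rmorph0 mul0r add0r.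
    apply: c_eq0 => //; apply: (fmorph_inj phi).
    by rewrite rmorph0 -[RHS]rel_x c2 c0 rmorph0 !mul0r add0r addr0.
  have sxE : sigma x = - (phi (c 0%N) * x + phi (c 1%N)) /
      (phi (c 2%N) * x + phi (c 0%N)).
    apply: (mulIf den_neq0); rewrite divfK //.
    by apply/eqP; rewrite -subr_eq0 -[X in _ == X]rel_x; apply/eqP; ring.
  have xi_sx : xi (sigma x) = sigma x.
    rewrite sxE fmorph_div rmorphN !(rmorphD xi, rmorphM xi) !xi_iota.
    by rewrite xi_x.
  have t_iota u : (sigma \o xi \o sigma) (iota u) = iota u.
    by rewrite /= !(eta_iota, xi_iota).
  have t_x : (sigma \o xi \o sigma) x = x.
    by rewrite [LHS]/= -[eta (xi (eta x))]/(sigma x) xi_sx; exact: sigmaK.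
  case: (xi_galois t_iota t_x) => /funeqP tE.
    case: xi_neq1; rewrite funeqE => u.
    have : sigma (xi (sigma (sigma u))) = sigma u := tE (sigma u).
    by rewrite sigmaK => /(can_inj sigmaK).
  by rewrite funeqE => u; have /= := tE u => ->; rewrite xiK.
have sx : sigma x = x.
  have : iter 2 (xi \o eta) x = x by rewrite d2.
  by move=> /(congr1 xi); rewrite /= xiK xi_x.
have [c2 c0 c1] : [/\ c 2%N = 0, 2%:R * c 0%N = 0 & c 1%N = 0].
  apply: quadratic_at_gen_eq0; rewrite -[RHS]rel_x sx rmorphM rmorph_nat; ring.
apply: c_eq0 => //; apply/eqP; move/eqP: c0; rewrite mulf_eq0 pnatr_eq0 //.
Qed.

End Criterion.

Theorem proposition2p11
    (R : realType) (p : int -> int -> R)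
    (p_ge0 : forall i j, i \in steps -> j \in steps -> 0 <= p i j)
    (p_sum1 : \sum_(i <- steps) \sum_(j <- steps) p i j = 1)
    (Q_irr : irreducible_elt (walkQ p))
    (Q_degy : size (walkQ p) = 3%N)
    (Q_degx : size (swapXY (walkQ p)) = 3%N)
    (F : fieldType) (iota : {rmorphism R[i] -> F}) (x y : F)
    (F_Q : is_function_field iota (walkQ p) x y)
    (F_genus : has_genus iota 1)
    (xi eta : {rmorphism F -> F})
    (xi_aut : is_automorphism iota xi)
    (xi_x : xi x = x)
    (xi_y : xi y = eval1 iota (walk_c p) x / (y * eval1 iota (walk_a p) x))
    (eta_aut : is_automorphism iota eta)
    (eta_y : eta y = y)
    (eta_x : eta x =
       eval1 iota (walk_c' p) y / (x * eval1 iota (walk_a' p) y)) :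
  generated_group [set (xi : F -> F); (eta : F -> F)] #= `I_8
  <-> \det (walkM p) = 0.
Proof.
pose pT i j := p j i.
have char2 : 2%:R != 0 :> R[i] by rewrite pnatr_eq0.
have [_ xi_iota] := xi_aut; have [_ eta_iota] := eta_aut.
have [a_neq0 FQ] : walk_a p != 0 /\ is_function_field iota
    ((walk_a p)%:P * 'X^2 + (walk_b p)%:P * 'X + (walk_c p)%:P) x y.
  rewrite walkQE in F_Q Q_degy; split; last exact: is_function_fieldN.
  apply: contra_eqN Q_degy => /eqP ->; rewrite size_polyN mul0r add0r.
  by rewrite ltn_eqF // ltnS size_linear_leq2.
have [a'_neq0 FQT] : walk_a' p != 0 /\ is_function_field iota
    ((walk_a' p)%:P * 'X^2 + (walk_b pT)%:P * 'X + (walk_c' p)%:P) y x.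
  have := is_function_field_swapXY F_Q; move: Q_degx.
  rewrite -walkQ_transpose walkQE => Q_degx' FQ'.
  split; last exact: is_function_fieldN.
  apply: contra_eqN Q_degx' => /eqP a'0.
  rewrite -[walk_a _]/(walk_a' p) a'0 size_polyN mul0r add0r.
  by rewrite ltn_eqF // ltnS size_linear_leq2.
have xiK := conj_involutive a_neq0 FQ xi_iota xi_x xi_y.
have etaK := conj_involutive a'_neq0 FQT eta_iota eta_y eta_x.
have xi_neq1 := conj_neq_id char2 a_neq0 FQ xi_y.
have eta_neq1 := conj_neq_id char2 a'_neq0 FQT eta_x.
pose phi : {rmorphism R -> F} := iota \o real_complex R.
have aE u : eval1 iota (walk_a p) u = walk_colF p phi 1 u.
  by rewrite eval1_quadratic /walk_colF subr0.
have bE u : eval1 iota (walk_b p) u = walk_colF p phi 0 u.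
  by rewrite eval1_quadratic /walk_colF rmorphB rmorph1.
have cE u : eval1 iota (walk_c p) u = walk_colF p phi (-1) u.
  by rewrite eval1_quadratic /walk_colF subr0.
have a'E u : eval1 iota (walk_a' p) u = walk_rowF p phi 1 u.
  by rewrite eval1_quadratic /walk_rowF subr0.
have b'E u : eval1 iota (walk_b pT) u = walk_rowF p phi 0 u.
  by rewrite eval1_quadratic /walk_rowF rmorphB rmorph1.
have c'E u : eval1 iota (walk_c' p) u = walk_rowF p phi (-1) u.
  by rewrite eval1_quadratic /walk_rowF subr0.
have eta_sum := conj_sum a'_neq0 FQT eta_x.
have eta_prod := conj_prod a'_neq0 FQT eta_x.
have xi_eta_sum : eval1 iota (walk_a' p) (xi y) * (x + xi (eta x)) =
    - eval1 iota (walk_b pT) (xi y).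
  have := congr1 xi eta_sum.
  by rewrite rmorphM rmorphD rmorphN !rmorph_eval1 // xi_x.
have xi_eta_prod : eval1 iota (walk_a' p) (xi y) * (x * xi (eta x)) =
    eval1 iota (walk_c' p) (xi y).
  have := congr1 xi eta_prod.
  by rewrite !rmorphM !rmorph_eval1 // xi_x.
have xi_sum := conj_sum a_neq0 FQ xi_y.
have xi_prod := conj_prod a_neq0 FQ xi_y.
rewrite !(aE, bE, cE) in xi_sum xi_prod.
rewrite !(a'E, b'E, c'E) in eta_sum eta_prod xi_eta_sum xi_eta_prod.
have [row1 row2 row3] := walkM_conj_roots (base_neq0 a_neq0 FQ) xi_sum xi_prod
  eta_sum xi_eta_sum eta_prod xi_eta_prod.
have U_neq0 : walkM_row p phi 2 x != 0.
  rewrite row2 mulf_neq0 ?expf_neq0 ?mulf_neq0 -?aE -?a'E //.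
  - exact: lead_neq0 a_neq0 FQ.
  - exact: lead_neq0 a'_neq0 FQT.
  - by rewrite -rmorph_eval1 // fmorph_eq0; exact: lead_neq0 a'_neq0 FQT.
rewrite -row2 in row1 row3.
have x_trans := eval1_eq0 a_neq0 FQ.
have galois := galois_quadratic a_neq0 FQ xi_iota xi_x xi_y.
apply: iff_trans (card_two_involutions_eq8 xiK etaK xi_neq1 eta_neq1) _.
split=> [[d4 d2]|].
  exact: (order_four_det0 xi_iota eta_iota xiK etaK xi_neq1 xi_x galois
            U_neq0 row1 row3 d4 d2).
exact: (det0_order_four xi_iota eta_iota xiK etaK xi_neq1 xi_x x_trans galois
            U_neq0 row1 row3).
Qed.
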